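(* Let $m,n\ge 1$ be integers and let $a_1,\dots,a_m,b_1,\dots,b_n$ be positive real numbers. In the toy scattering model with $m$ type A particles of speeds $a_1,\dots,a_m$ and $n$ type B particles of speeds $b_1,\dots,b_n$, the probability $P(\text{A wins})$ does not depend on the initial positions of the particles (among positions for which every type A particle is to the left of every type B particle). In particular, if $(a_1',\dots,a_m')$ is any permutation of $(a_1,\dots,a_m)$ and $(b_1',\dots,b_n')$ is any permutation of $(b_1,\dots,b_n)$, then assigning speed $a_i'$ to $A_i$ and $b_j'$ to $B_j$, with the same initial positions, gives the same value of $P(\text{A wins})$.
   Context: Toy scattering model. There are $m$ type A particles $A_1,\dots,A_m$ with speeds $a_1,\dots,a_m>0$ and $n$ type B particles $B_1,\dots,B_n$ with speeds $b_1,\dots,b_n>0$ on the real line. Type A particles move in the positive direction and type B particles in the negative direction, at constant speed. Initially $A_i$ is at position $u_i\in\mathbb{R}$ and $B_j$ at position $v_j\in\mathbb{R}$, with $u_i<v_j$ for all $i,j$. Particles of the same type pass freely through each other. If $A_i$ and $B_j$ are both still alive at their meeting time $t_{ij}=(v_j-u_i)/(a_i+b_j)$, they collide: with probability $a_i/(a_i+b_j)$ particle $A_i$ survives and $B_j$ is annihilated, and with probability $b_j/(a_i+b_j)$ particle $B_j$ survives and $A_i$ is annihilated; the survivor continues with unchanged velocity. Outcomes of different collisions are independent. Pairs $(i,j)$ are processed in nondecreasing order of $t_{ij}$, ties being broken by an arbitrary fixed order. The process continues until only one type of particle survives. ''A wins'' is the event that all type B particles are annihilated; ''B wins'' is the event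 that all type A particles are annihilated. *)

(* Defs.v *)
From mathcomp Require Import all_boot all_order all_algebra.
From mathcomp Require Import reals.

Set Implicit Arguments.
Unset Strict Implicit.
Unset Printing Implicit Defensive.

Import Order.TTheory GRing.Theory Num.Theory.
Local Open Scope ring_scope.

(* The type A particles are indexed by 'I_m and have speeds a and initial
   positions u; the type B particles are indexed by 'I_n and have speeds b and
   initial positions v. *)

Definition separated (R : realType) (m n : nat)
    (u : 'I_m -> R) (v : 'I_n -> R) : Prop :=
  forall i j, u i < v j.

Definition meeting_time (R : realType) (m n : nat)
    (a : 'I_m -> R) (b : 'I_n -> R) (u : 'I_m -> R) (v : 'I_n -> R)
    (p : 'I_m * 'I_n) : R :=
  (v p.2 - u p.1) / (a p.1 + b p.2).

(* s lists every pair exactly once, in nondecreasing order of meeting time;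
   the relative order of pairs with equal meeting times is unconstrained. *)
Definition processing_order (R : realType) (m n : nat)
    (a : 'I_m -> R) (b : 'I_n -> R) (u : 'I_m -> R) (v : 'I_n -> R)
    (s : seq ('I_m * 'I_n)) : Prop :=
  perm_eq s (enum {: 'I_m * 'I_n}) /\
  sorted (fun p q => meeting_time a b u v p <= meeting_time a b u v q) s.

(* The sample space has one coin per pair: w (i, j) = true means that A_i is
   the survivor of a collision between A_i and B_j. A pair meets at most once;
   its coin is ignored if the two particles are not both alive when they
   meet. *)
Definition outcome (m n : nat) := {ffun 'I_m * 'I_n -> bool}.

(* The sets of type A and type B particles that are still alive. *)
Definition state (m n : nat) := ({set 'I_m} * {set 'I_n})%type.

Definition collide (m n : nat) (w : outcome m n)
    (st : state m n) (p : 'I_m * 'I_n) : state m n :=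
  if (p.1 \in st.1) && (p.2 \in st.2) then
    if w p then (st.1, st.2 :\ p.2) else (st.1 :\ p.1, st.2)
  else st.

(* Nothing changes once one type has been annihilated, so running through the
   whole list agrees with stopping at that time. *)
Definition final_state (m n : nat) (s : seq ('I_m * 'I_n)) (w : outcome m n) :
    state m n :=
  foldl (collide w) ([set: 'I_m], [set: 'I_n]) s.

Definition A_wins (m n : nat) (s : seq ('I_m * 'I_n)) (w : outcome m n) :
    bool :=
  (final_state s w).2 == set0.

(* The law making the coins independent, the coin of (i, j) being true with
   probability a_i / (a_i + b_j). *)
Definition coin_law (R : realType) (m n : nat)
    (a : 'I_m -> R) (b : 'I_n -> R) (w : outcome m n) : R :=
  \prod_p (if w p then a p.1 / (a p.1 + b p.2) else b p.2 / (a p.1 + b p.2)).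

Definition prob (R : realType) (m n : nat)
    (a : 'I_m -> R) (b : 'I_n -> R) (E : pred (outcome m n)) : R :=
  \sum_(w | E w) coin_law a b w.

(* Main.v *)
(** The model is a gladiator game: each fight between living particles [A_i] and
    [B_j] is won by [A_i] with probability [a_i / (a_i + b_j)]. Let the particles
    have independent exponential lifetimes of means [a_i] and [b_j], which elapse
    only while they fight. By memorylessness, A wins iff the total lifetime of the
    A's exceeds that of the B's, whatever the order of the fights. In algebraic
    form, there is a function [f S T] of the sets of living particles with
    [f S T = (a_i f S (T - j) + b_j f (S - i) T) / (a_i + b_j)] for all [i] in [S]
    and all [j] in [T] simultaneously. Along the process [f] is then a martingale
    which ends at the indicator of the event that A wins. *)
Require Import Defs.
From mathcomp Require Import all_boot all_order all_fingroup all_algebra.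
From mathcomp Require Import reals.
From mathcomp Require Import ring lra zify.

Set Implicit Arguments.
Unset Strict Implicit.
Unset Printing Implicit Defensive.

Import Order.TTheory GRing.Theory Num.Theory.
Local Open Scope ring_scope.

(** * Existence of the harmonic function, by induction on the number of particles *)

Section WinningValue.

Variables (R : realFieldType) (I J : finType) (a : I -> R) (b : J -> R).

Implicit Types (S : {set I}) (T : {set J}) (f : {set I} -> {set J} -> R).

Definition fight_mean f S T i j : R :=
  (a i * f S (T :\ j) + b j * f (S :\ i) T) / (a i + b j).

Definition boundary f : Prop :=
  (forall S, f S set0 = 1) /\ (forall T, T != set0 -> f set0 T = 0).

Definition harmonic_upto (k : nat) f : Prop :=
  forall S T i j, (#|S| + #|T| <= k)%N -> i \in S -> j \in T ->
    f S T = fight_mean f S T i j.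

Definition winning_value f : Prop :=
  boundary f /\
  forall S T i j, i \in S -> j \in T -> f S T = fight_mean f S T i j.

Hypotheses (a_gt0 : forall i, 0 < a i) (b_gt0 : forall j, 0 < b j).

(* [g1 - g = b1 D] and [g2 - g = b2 D] with the common slope [D = (g - h) / c]. *)
Lemma equal_slopes (c b1 b2 g g1 g2 h : R) :
  0 < c -> 0 < b1 -> 0 < b2 ->
  g = (c * g1 + b1 * h) / (c + b1) -> g = (c * g2 + b2 * h) / (c + b2) ->
  b2 * (g1 - g) = b1 * (g2 - g).
Proof.
move=> c0 b10 b20 e1 e2.
have h1 : c * (g1 - g) = b1 * (g - h) by rewrite e1; field; lra.
have h2 : c * (g2 - g) = b2 * (g - h) by rewrite e2; field; lra.
have c_neq0 : c != 0 by lra.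
by apply: (mulfI c_neq0); rewrite mulrCA h1 mulrCA [RHS]mulrCA h2; ring.
Qed.

(** The term in [u] is symmetric in [q] and [r] and cancels; the two sides differ by a multiple of
    the defect in the slope condition. *)
Lemma two_step_means (p q r u g gq gr : R) :
  0 < p + q -> 0 < p + r -> r * (gq - g) = q * (gr - g) ->
  (p * ((p * u + r * gq) / (p + r)) + q * g) / (p + q) =
  (p * ((p * u + q * gr) / (p + q)) + r * g) / (p + r).
Proof.
move=> pq pr slope; apply/eqP; rewrite -subr_eq0; apply/eqP.
transitivity (p * (r * (gq - g) - q * (gr - g)) / ((p + q) * (p + r))).
  by field; lra.
by rewrite slope subrr mulr0 mul0r.
Qed.

(** After [i] kills one of [j1], [j2], let it fight the other: the state where both are dead is
    common to the two orders. [two_step_means] then asks for equal slopes at [S :\ i]. *)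
Lemma fight_mean_swapB k f S T i j1 j2 :
  boundary f -> harmonic_upto k f -> (#|S| + #|T| <= k.+1)%N ->
  i \in S -> j1 \in T -> j2 \in T ->
  fight_mean f S T i j1 = fight_mean f S T i j2.
Proof.
move=> [_ f0T] hf leST iS j1T j2T.
have [-> //|j12] := eqVneq j1 j2.
have cS := cardsD1 i S; rewrite iS /= in cS.
have c1 := cardsD1 j1 T; rewrite j1T /= in c1.
have c2 := cardsD1 j2 T; rewrite j2T /= in c2.
have j21' : j2 \in T :\ j1 by rewrite !inE eq_sym j12.
have j12' : j1 \in T :\ j2 by rewrite !inE j12.
have e1 : f S (T :\ j1) = fight_mean f S (T :\ j1) i j2 by apply: hf => //; lia.
have e2 : f S (T :\ j2) = fight_mean f S (T :\ j2) i j1 by apply: hf => //; lia.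
have slope : b j2 * (f (S :\ i) (T :\ j1) - f (S :\ i) T) =
             b j1 * (f (S :\ i) (T :\ j2) - f (S :\ i) T).
  (* If no A is left, all three values are 0; otherwise any remaining [k'] provides the common
     slope. *)
  have [->|[k' k'S]] := set_0Vmem (S :\ i).
    by rewrite !f0T ?subrr ?mulr0 //; apply/set0Pn; [exists j1|exists j1|exists j2].
  have g1 : f (S :\ i) T = fight_mean f (S :\ i) T k' j1 by apply: hf => //; lia.
  have g2 : f (S :\ i) T = fight_mean f (S :\ i) T k' j2 by apply: hf => //; lia.
  exact: (equal_slopes (a_gt0 k') (b_gt0 j1) (b_gt0 j2) g1 g2).
rewrite /fight_mean in e1 e2 *; rewrite e1 e2 !setDDl [[set j2] :|: _]setUC.
by apply: two_step_means => //; exact: addr_gt0.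
Qed.

Lemma fight_mean_swapA k f S T i1 i2 j :
  boundary f -> harmonic_upto k f -> (#|S| + #|T| <= k.+1)%N ->
  i1 \in S -> i2 \in S -> j \in T ->
  fight_mean f S T i1 j = fight_mean f S T i2 j.
Proof.
move=> [fS0 _] hf leST i1S i2S jT.
have [-> //|i12] := eqVneq i1 i2.
have cT := cardsD1 j T; rewrite jT /= in cT.
have c1 := cardsD1 i1 S; rewrite i1S /= in c1.
have c2 := cardsD1 i2 S; rewrite i2S /= in c2.
have i21' : i2 \in S :\ i1 by rewrite !inE eq_sym i12.
have i12' : i1 \in S :\ i2 by rewrite !inE i12.
have e1 : f (S :\ i1) T = fight_mean f (S :\ i1) T i2 j by apply: hf => //; lia.
have e2 : f (S :\ i2) T = fight_mean f (S :\ i2) T i1 j by apply: hf => //; lia.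
have slope : a i2 * (f (S :\ i1) (T :\ j) - f S (T :\ j)) =
             a i1 * (f (S :\ i2) (T :\ j) - f S (T :\ j)).
  have [->|[k' k'T]] := set_0Vmem (T :\ j).
    by rewrite !fS0 !subrr !mulr0.
  have g1 : f S (T :\ j) = fight_mean f S (T :\ j) i1 k' by apply: hf => //; lia.
  have g2 : f S (T :\ j) = fight_mean f S (T :\ j) i2 k' by apply: hf => //; lia.
  (* The roles of A and B are exchanged: [b k'] is now the common weight of [equal_slopes]. *)
  rewrite /fight_mean addrC (addrC (a _)) in g1.
  rewrite /fight_mean addrC (addrC (a _)) in g2.
  exact: (equal_slopes (b_gt0 k') (a_gt0 i1) (a_gt0 i2) g1 g2).
rewrite /fight_mean in e1 e2 *; rewrite e1 e2 !setDDl [[set i2] :|: _]setUC.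
rewrite ![a _ * _ + _]addrC ![a _ + b _]addrC.
by apply: two_step_means => //; exact: addr_gt0.
Qed.

(** Values at level [k.+1] are defined by the fight of one chosen pair; the two swap lemmas show
    that the choice is immaterial. *)
Lemma harmonic_upto_exists k : exists f, boundary f /\ harmonic_upto k f.
Proof.
elim: k => [|k [f [bf hf]]].
  exists (fun _ T => (T == set0)%:R); split.
    by split=> [S|T /negPf->]; rewrite ?eqxx.
  by move=> S T i j; rewrite (cardsD1 i) => + iS; rewrite iS.
pose f' S T := if (#|S| + #|T| <= k)%N then f S T else
  if [pick i in S] is Some i then
    if [pick j in T] is Some j then fight_mean f S T i j else 1
  else (T == set0)%:R.
have f'E S T : (#|S| + #|T| <= k)%N -> f' S T = f S T by rewrite /f' => ->.
exists f'; split.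
  split=> [S|T T0]; rewrite /f'; case: ifP => _.
  - exact: bf.1.
  - case: pickP => [i _|_]; last by rewrite eqxx.
    by case: pickP => // j; rewrite inE.
  - exact: bf.2.
  - by case: pickP => [i|_]; rewrite ?inE ?(negPf T0).
move=> S T i j leST iS jT.
have cT := cardsD1 j T; rewrite jT /= in cT.
have cS := cardsD1 i S; rewrite iS /= in cS.
have -> : fight_mean f' S T i j = fight_mean f S T i j.
  by rewrite /fight_mean !f'E //; lia.
rewrite /f'; case: ifP => [le|_]; first exact: (hf S T i j).
case: pickP => [i0 i0S|/(_ i)]; last by rewrite iS.
case: pickP => [j0 j0T|/(_ j)]; last by rewrite jT.
by rewrite (@fight_mean_swapB k f S T i0 j0 j) // (@fight_mean_swapA k f S T i0 i j).
Qed.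

Lemma winning_value_exists : exists f, winning_value f.
Proof.
have [f [bf hf]] := harmonic_upto_exists (#|I| + #|J|).
exists f; split=> // S T i j; apply: hf.
by apply: leq_add; exact: max_card.
Qed.

End WinningValue.

(** Relabelling particles transports a winning value to the permuted speeds. *)
Lemma winning_value_imset (R : realFieldType) (I J : finType)
    (a a' : I -> R) (b b' : J -> R) (sigma : {perm I}) (tau : {perm J})
    (f : {set I} -> {set J} -> R) :
  (forall i, a' i = a (sigma i)) -> (forall j, b' j = b (tau j)) ->
  winning_value a b f ->
  winning_value a' b' (fun S T => f (sigma @: S) (tau @: T)).
Proof.
move=> ea eb [[fS0 f0T] hf]; split.
  by split=> [S|T T0]; rewrite imset0 ?fS0 // f0T // imset_eq0.
have imsetD1 (K : finType) (s : {perm K}) A k : s @: (A :\ k) = (s @: A) :\ s k.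
  apply/setP=> x; rewrite -(permKV s x) !inE !mem_imset ?inE; try exact: perm_inj.
  by rewrite (inj_eq perm_inj).
move=> S T i j iS jT; rewrite (hf _ _ (sigma i) (tau j)) ?imset_f //.
by rewrite /fight_mean !imsetD1 ea eb.
Qed.

(** * The martingale along the process *)

Section Process.

Variables (R : realType) (m n : nat) (a : 'I_m -> R) (b : 'I_n -> R).
Hypotheses (a_gt0 : forall i, 0 < a i) (b_gt0 : forall j, 0 < b j).

Implicit Types (p q : 'I_m * 'I_n) (s : seq ('I_m * 'I_n)).
Implicit Types (w : outcome m n) (st : state m n).

Definition flip p w : outcome m n := [ffun q => if q == p then ~~ w q else w q].

Lemma flipK p : involutive (flip p).
Proof.
by move=> w; apply/ffunP=> q; rewrite !ffunE; case: (q == p); rewrite ?negbK.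
Qed.

Lemma foldl_collide_flip p w st s :
  p \notin s -> foldl (collide (flip p w)) st s = foldl (collide w) st s.
Proof.
elim: s st => //= q s IHs st; rewrite inE negb_or => /andP[pq ps].
by rewrite IHs // /collide ffunE eq_sym (negPf pq).
Qed.

Lemma sum_coin_law : \sum_w coin_law a b w = 1.
Proof.
rewrite /coin_law.
rewrite -(bigA_distr_bigA (fun p (c : bool) =>
  if c then a p.1 / (a p.1 + b p.2) else b p.2 / (a p.1 + b p.2))).
apply: big1 => p _; rewrite big_bool /= -mulrDl divff //.
by have := a_gt0 p.1; have := b_gt0 p.2; lra.
Qed.

Definition expected_value (f : {set 'I_m} -> {set 'I_n} -> R) st s : R :=
  \sum_w coin_law a b w *
    f (foldl (collide w) st s).1 (foldl (collide w) st s).2.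

(* The coin of [p] is not consulted during [s], so the outcomes [w] and
   [flip p w] lead to the same state before [p] is processed; their
   contributions to the increment at [p] cancel. *)
Lemma expected_value_rcons f st s p : winning_value a b f -> p \notin s ->
  expected_value f st (rcons s p) = expected_value f st s.
Proof.
move=> [_ hf] ps; apply/eqP; rewrite -subr_eq0 -sumrB; set X := \sum_w _.
(* Reindexing one copy of [X] by [flip p] pairs each outcome with its flip. *)
suff : X + X = 0 by move=> h; apply/eqP; lra.
rewrite {2}/X (reindex_inj (inv_inj (flipK p))) /X -big_split /=.
apply: big1 => w _; rewrite !foldl_rcons !foldl_collide_flip // -!mulrBr.
move: (foldl _ _ _) => st'.
rewrite /coin_law (bigD1 p) //= [X in _ + X * _](bigD1 p) //=.
set r := \prod_(_ | _) _; set r' := \prod_(_ | _) _.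
have -> : r' = r by apply: eq_bigr => q /negPf qp; rewrite ffunE qp.
rewrite /collide ffunE eqxx; case: andP => [[p1 p2]|_]; last first.
  by rewrite subrr !mulr0 addr0.
rewrite (hf _ _ _ _ p1 p2) /fight_mean.
have := a_gt0 p.1; have := b_gt0 p.2.
by case: (w p) => /= ? ?; field; lra.
Qed.

Lemma expected_value_foldl f st s : winning_value a b f -> uniq s ->
  expected_value f st s = f st.1 st.2.
Proof.
move=> wf; elim/last_ind: s => [_|s p IHs].
  by rewrite /expected_value /= -mulr_suml sum_coin_law mul1r.
by rewrite rcons_uniq => /andP[ps us]; rewrite expected_value_rcons // IHs.
Qed.

Lemma foldl_collide_sub w st s :
  ((foldl (collide w) st s).1 \subset st.1) &&
  ((foldl (collide w) st s).2 \subset st.2).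
Proof.
elim: s st => [|p s IHs] st /=; first by rewrite !subxx.
have /andP[h1 h2] := IHs (collide w st p).
rewrite (subset_trans h1) ?(subset_trans h2) // /collide;
  by case: ifP => // _; case: ifP => // _; rewrite subD1set.
Qed.

(** Processing [p] leaves at most one of its particles alive, and the dead stay dead. *)
Lemma foldl_collide_not_both w st s p : p \in s ->
  ~~ ((p.1 \in (foldl (collide w) st s).1) &&
      (p.2 \in (foldl (collide w) st s).2)).
Proof.
elim: s st => //= q s IHs st; rewrite inE => /orP[/eqP<-|]; last exact: IHs.
have /andP[/subsetP h1 /subsetP h2] := foldl_collide_sub w (collide w st p) s.
apply/negP=> /andP[/h1 + /h2]; rewrite /collide.
case: ifP => [_|pst p1 p2]; last by rewrite p1 p2 in pst.
by case: ifP => _ /=; rewrite !inE eqxx.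
Qed.

(** At the end one type is extinct, so [f] there is the indicator of [A_wins]; its expectation is
    the initial value, which does not involve [s]. *)
Lemma prob_A_wins f s : winning_value a b f -> perm_eq s (enum {: 'I_m * 'I_n}) ->
  prob a b (A_wins s) = f setT setT.
Proof.
move=> wf ps; have us : uniq s by rewrite (perm_uniq ps) enum_uniq.
rewrite -(expected_value_foldl ([set: 'I_m], [set: 'I_n]) wf us).
rewrite /prob big_mkcond; apply: eq_bigr => w _; rewrite /A_wins.
have [[fS0 f0T] _] := wf.
rewrite -/(final_state s w).
case: ifPn => [/eqP->|T0]; first by rewrite fS0 mulr1.
suff -> : (final_state s w).1 = set0 by rewrite f0T // mulr0.
have [j jT] := set0Pn _ T0; apply/setP=> i; rewrite inE; apply/negbTE/negP=> iS.
have : (i, j) \in s by rewrite (perm_mem ps) mem_enum.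
move/(@foldl_collide_not_both w ([set: 'I_m], [set: 'I_n])).
by rewrite -/(final_state s w) /= iS jT.
Qed.

End Process.

Theorem mainTheorem3 (R : realType) (m n : nat)
    (a : 'I_m -> R) (b : 'I_n -> R)
    (m_gt0 : (0 < m)%N) (n_gt0 : (0 < n)%N)
    (a_gt0 : forall i, 0 < a i) (b_gt0 : forall j, 0 < b j) :
  (forall (u u' : 'I_m -> R) (v v' : 'I_n -> R) (s s' : seq ('I_m * 'I_n)),
     separated u v -> separated u' v' ->
     processing_order a b u v s -> processing_order a b u' v' s' ->
     prob a b (A_wins s) = prob a b (A_wins s'))
  /\
  (forall (sigma : 'S_m) (tau : 'S_n) (a' : 'I_m -> R) (b' : 'I_n -> R)
          (u : 'I_m -> R) (v : 'I_n -> R) (s s' : seq ('I_m * 'I_n)),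
     (forall i, a' i = a (sigma i)) -> (forall j, b' j = b (tau j)) ->
     separated u v ->
     processing_order a b u v s -> processing_order a' b' u v s' ->
     prob a' b' (A_wins s') = prob a b (A_wins s)).
Proof.
have [f wf] := winning_value_exists a_gt0 b_gt0.
split=> [u u' v v' s s' _ _ [ps _] [ps' _]|].
  by rewrite !(prob_A_wins a_gt0 b_gt0 wf).
move=> sigma tau a' b' u v s s' ea eb _ [ps _] [ps' _].
have wf' := winning_value_imset ea eb wf.
have a'_gt0 i : 0 < a' i by rewrite ea.
have b'_gt0 j : 0 < b' j by rewrite eb.
rewrite (prob_A_wins a_gt0 b_gt0 wf ps).
rewrite (prob_A_wins a'_gt0 b'_gt0 wf' ps').
(* The relabelled value is taken at the full sets, which permutations fix. *)
have imsetT (K : finType) (r : {perm K}) : r @: setT = setT.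
  by apply/setP=> x; rewrite -(permKV r x) mem_imset ?inE //; exact: perm_inj.
by rewrite !imsetT.
Qed.
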